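(* Consider a finite MDP $\langle\mathcal S,\mathcal A,(\mathcal A(s),s\in\mathcal S),P,r\rangle$ such that the Markov chain under every randomized stationary policy is ergodic (irreducible and aperiodic), and let $\alpha\in(0,1]$. Starting from any initial policy $u^{(0)}\in\mathcal U^{\rm DS}$, the policy iteration algorithm for steady-state VaR maximization (described in the context) stops after finitely many iterations, and the policy $u^{(n)}$ at which it stops is optimal for the steady-state VaR maximization MDP, i.e. $\mathrm{VaR}^{u^{(n)}}=\mathrm{VaR}^*:=\sup_{u\in\mathcal U^{\rm RS}}\mathrm{VaR}^u$.
   Context: MDP: $\mathcal S$ and $\mathcal A$ are finite sets; $\mathcal A(s)\subseteq\mathcal A$ is the nonempty set of admissible actions in $s$, with $\cup_s\mathcal A(s)=\mathcal A$; $\mathcal K:=\{(s,a):s\in\mathcal S,a\in\mathcal A(s)\}$; $P(\cdot|s,a)$ is a probability distribution on $\mathcal S$ for each $(s,a)\in\mathcal K$; $r:\mathcal K\to\mathbb R$ is the reward function. Policies: $\mathcal U^{\rm RS}$ is the set of randomized stationary policies, i.e. maps $s\mapsto u(\cdot|s)$ with $u(\cdot|s)$ a probability distribution on $\mathcal A(s)$; $\mathcal U^{\rm DS}$ is the subset of deterministic ones (maps $u:\mathcal S\to\mathcal A$ with $u(s)\in\mathcal A(s)$). Under $u$, the state process is a Markov chain on $\mathcal S$ with transition matrix $\sum_{a}u(a|s)P(s'|s,a)$, and $\pi^u(s,a):=\lim_{t\to\infty}\mathbb P^u_{s_0}(s_t=s,a_t=a)$, which by ergodicity exists and does not depend on $s_0$.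 Steady-state quantities: $R^u_\infty$ is the random variable $r(s,a)$ with $(s,a)\sim\pi^u$; $\Lambda:=\{r(s,a):(s,a)\in\mathcal K\}$; for $\lambda\in\mathbb R$, $F^u(\lambda):=\mathbb P(R^u_\infty\le\lambda)$; $\mathrm{VaR}^u:=\inf\{\lambda\in\mathbb R:F^u(\lambda)\ge\alpha\}=\min\{\lambda\in\Lambda:F^u(\lambda)\ge\alpha\}$. Algorithm. Choose $u^{(0)}\in\mathcal U^{\rm DS}$ arbitrarily and set $k=0$. At iteration $k$: (policy evaluation) compute $\lambda_k:=\mathrm{VaR}^{u^{(k)}}$; (policy improvement) compute $F^*(\lambda_k):=\min_{u\in\mathcal U^{\rm DS}}F^u(\lambda_k)$ and some minimizer $\hat u^*\in\arg\min_{u\in\mathcal U^{\rm DS}}F^u(\lambda_k)$. If $F^*(\lambda_k)<\alpha$, set $u^{(k+1)}:=\hat u^*$, increase $k$ by one, and repeat; otherwise stop and return $u^{(k)}$ and $\mathrm{VaR}^{u^{(k)}}$. *)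

(* Defs.v *)
From HB Require Import structures.
From mathcomp Require Import all_boot all_order all_algebra.
From mathcomp Require Import all_classical all_reals all_analysis.
Import Order.TTheory GRing.Theory Num.Theory.
Import numFieldNormedType.Exports.

Set Implicit Arguments.
Unset Strict Implicit.
Unset Printing Implicit Defensive.

Local Open Scope classical_set_scope.
Local Open Scope ring_scope.

Section MarkovChain.
Context {R : realType} {S : finType}.
Implicit Types Q : S -> S -> R.

Fixpoint nstep Q (t : nat) (s s' : S) : R :=
  if t is t'.+1 then \sum_(x : S) nstep Q t' s x * Q x s' else (s == s')%:R.

Definition mc_irreducible Q : Prop :=
  forall s s' : S, exists t : nat, 0 < nstep Q t s s'.

(* The gcd of the return times of every state is 1. *)
Definition mc_aperiodic Q : Prop :=
  forall (s : S) (d : nat),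
    (forall t : nat, (0 < t)%N -> 0 < nstep Q t s s -> (d %| t)%N) -> d = 1%N.

Definition mc_ergodic Q : Prop := mc_irreducible Q /\ mc_aperiodic Q.

End MarkovChain.

(* [trans] and [reward] are total functions, but only their values at
   admissible pairs are constrained or matter. *)
Record mdp (R : realType) (S A : finType) := MDP {
  adm : S -> {set A};
  adm_nonempty : forall s, exists a, a \in adm s;
  adm_cover : forall a, exists s, a \in adm s;
  trans : S -> A -> S -> R;
  trans_ge0 : forall s a s', a \in adm s -> 0 <= trans s a s';
  trans_sum1 : forall s a, a \in adm s -> \sum_(s' : S) trans s a s' = 1;
  reward : S -> A -> R
}.

Section VaR.
Context {R : realType} {S A : finType}.
Variable M : mdp R S A.

(* [u s a] is the probability u(a|s). *)
Definition U_RS : set (S -> A -> R) :=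
  [set u | forall s, [/\ forall a, 0 <= u s a,
                         forall a, a \notin adm M s -> u s a = 0
                       & \sum_(a : A) u s a = 1]].

Definition U_DS : set {ffun S -> A} :=
  [set d | forall s, d s \in adm M s].

(* The inclusion of deterministic policies into randomized ones. *)
Definition det (d : {ffun S -> A}) : S -> A -> R := fun s a => (a == d s)%:R.

Definition chain (u : S -> A -> R) (s s' : S) : R :=
  \sum_(a in adm M s) u s a * trans M s a s'.

(* Probability, from initial state s0 and under u, of the trajectory h of
   state-action pairs (s_0,a_0), ..., (s_t,a_t). *)
Definition traj_prob (u : S -> A -> R) (s0 : S) (t : nat)
    (h : {ffun 'I_t.+1 -> S * A}) : R :=
  ((h ord0).1 == s0)%:R
  * (\prod_(i < t.+1) u (h i).1 (h i).2)
  * \prod_(i < t) trans M (h (widen_ord (leqnSn t) i)).1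
                          (h (widen_ord (leqnSn t) i)).2
                          (h (lift ord0 i)).1.

Definition prob_at (u : S -> A -> R) (s0 : S) (t : nat) (s : S) (a : A) : R :=
  \sum_(h : {ffun 'I_t.+1 -> S * A} | h ord_max == (s, a)) traj_prob u s0 h.

(* The initial state s0 is kept as an explicit parameter of the limit and of
   everything defined from it; under ergodicity nothing depends on it. *)
Definition steady (u : S -> A -> R) (s0 : S) (s : S) (a : A) : R :=
  lim (prob_at u s0 t s a @[t --> \oo]).

Definition Fcdf (s0 : S) (u : S -> A -> R) (l : R) : R :=
  \sum_(s : S) \sum_(a in adm M s | reward M s a <= l) steady u s0 s a.

Definition VaR (s0 : S) (alpha : R) (u : S -> A -> R) : R :=
  inf [set l : R | alpha <= Fcdf s0 u l].

Definition VaR_star (s0 : S) (alpha : R) : R :=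
  sup [set VaR s0 alpha u | u in U_RS].

(* A minimum, since U_DS is finite and nonempty. *)
Definition F_star (s0 : S) (l : R) : R :=
  inf [set Fcdf s0 (det d) l | d in U_DS].

Definition argmin_DS (s0 : S) (l : R) : set {ffun S -> A} :=
  [set d | U_DS d /\ forall d', U_DS d' -> Fcdf s0 (det d) l <= Fcdf s0 (det d') l].

Definition continues (s0 : S) (alpha : R) (d : {ffun S -> A}) : Prop :=
  F_star s0 (VaR s0 alpha (det d)) < alpha.

(* [u] lists the iterates, with an arbitrary choice of minimizer at each step;
   its values after the algorithm has stopped are irrelevant. *)
Definition PI_run (s0 : S) (alpha : R) (u : nat -> {ffun S -> A}) : Prop :=
  U_DS (u 0%N) /\
  forall k : nat, (forall j : nat, (j <= k)%N -> continues s0 alpha (u j)) ->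
    argmin_DS s0 (VaR s0 alpha (det (u k))) (u k.+1).

Definition PI_stops_at (s0 : S) (alpha : R) (u : nat -> {ffun S -> A})
    (n : nat) : Prop :=
  (forall k : nat, (k < n)%N -> continues s0 alpha (u k)) /\
  ~ continues s0 alpha (u n).

End VaR.

(* Main.v *)
(** Each improvement step strictly raises the VaR, because [alpha <= F l] is
    equivalent to [VaR <= l]; as there are finitely many deterministic policies,
    the algorithm stops. When it stops at VaR [l], every deterministic policy has
    [F l >= alpha], so it remains to see that some deterministic policy minimizes
    [F l] over randomized ones. Randomization is removed one state at a time: if
    [u_a] is [u] modified to play [a] at [s], and [mu_a] is its stationary law,
    then [\sum_a u(a|s) / mu_a(s) * mu_a] is invariant under [u]. By uniqueness it
    is a multiple of the stationary law of [u], so [F^u] is a weighted average of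
    the [F^(u_a)]. *)
Require Import Defs.
From HB Require Import structures.
From mathcomp Require Import all_boot all_order all_algebra.
From mathcomp Require Import all_classical all_reals all_analysis.
From mathcomp Require Import zify ring lra.
Import Order.TTheory GRing.Theory Num.Theory.
Import numFieldNormedType.Exports.
Local Open Scope classical_set_scope.
Local Open Scope ring_scope.

(* The least positive difference of two elements of [T] divides all of [T], hence
   is 1; two consecutive elements then generate all large numbers. *)
Lemma add_closed_cofinite (T : pred nat) :
  T 0%N -> (forall m n, T m -> T n -> T (m + n)%N) ->
  (forall d, (forall t, (0 < t)%N -> T t -> (d %| t)%N) -> d = 1%N) ->
  exists N, forall n, (N <= n)%N -> T n.
Proof.
move=> T0 Tadd Tgcd.
have Tmul k m : T m -> T (k * m)%N.
  by move=> Tm; elim: k => [//|k IHk]; rewrite mulSn; exact: Tadd.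
pose G := [pred d : nat | (0 < d)%N && `[< exists m, T m /\ T (m + d)%N >]].
have exG : exists d, G d.
  apply: contrapT => /forallNP noG.
  suff: 0%N = 1%N by [].
  apply: Tgcd => t t0 Tt; case: (noG t).
  by rewrite /G /= t0; apply/asboolP; exists 0%N; rewrite add0n.
have [d /andP[d0 /asboolP[m [Tm Tmd]]] dmin] := ex_minnP exG.
have d1 : d = 1%N.
  apply: Tgcd => t t0 Tt; rewrite /dvdn; apply: contrapT => /negP r0.
  have /dmin : G (t %% d)%N.
    (* With [q = t %/ d], both [q * (m + d)] and [t + q * m] lie in [T], and their difference is the
       remainder [t %% d], which is below the minimal [d]. *)
    rewrite /G /= lt0n r0; apply/asboolP; exists ((t %/ d) * (m + d))%N.
    split; first exact: Tmul.
    suff -> : ((t %/ d) * (m + d) + t %% d = t + (t %/ d) * m)%N.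
      by apply: Tadd => //; exact: Tmul.
    by rewrite mulnDr -addnA -divn_eq addnC.
  by rewrite leqNgt ltn_mod d0.
move: Tmd; rewrite {}d1 addn1 => Tm1.
(* From [m * m] on, the quotient [q] of [n] by [m] is at least the remainder [r], so
   [n = (q - r) * m + r * (m + 1)] has natural coefficients. *)
exists (m * m)%N => n mn.
have [m0|m0] := posnP m.
  by rewrite -[n]muln1; apply: Tmul; rewrite m0 in Tm1.
have rq : (n %% m <= n %/ m)%N.
  by apply: ltnW; apply: leq_trans (ltn_pmod _ m0) _; rewrite leq_divRL.
suff -> : n = ((n %/ m - n %% m) * m + (n %% m) * m.+1)%N.
  by apply: Tadd; exact: Tmul.
rewrite {1}(divn_eq n m) mulnS addnCA -mulnDl subnK //; lia.
Qed.

(** * Powers of a stochastic matrix: eventual positivity and contraction *)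

Section StochasticMatrix.
Context {R : realType} {S : finType}.
Variable Q : S -> S -> R.
Hypothesis Q_ge0 : forall x y, 0 <= Q x y.
Hypothesis Q_sum1 : forall x, \sum_y Q x y = 1.

Lemma nstep_ge0 t x y : 0 <= nstep Q t x y.
Proof.
elim: t y => [|t IHt] y /=; first exact: ler0n.
by apply: sumr_ge0 => z _; apply: mulr_ge0.
Qed.

Lemma nstep_add t t' x y :
  nstep Q (t + t') x y = \sum_z nstep Q t x z * nstep Q t' z y.
Proof.
elim: t' y => [|t' IHt] y.
  rewrite addn0 /= (bigD1 y)//= eqxx mulr1 big1 ?addr0// => z /negPf ->.
  by rewrite mulr0.
rewrite addnS /=.
under eq_bigr do rewrite IHt mulr_suml.
rewrite exchange_big/=; apply: eq_bigr => z _.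
by rewrite mulr_sumr; apply: eq_bigr => w _; rewrite mulrA.
Qed.

Lemma nstep_sum1 t x : \sum_y nstep Q t x y = 1.
Proof.
elim: t => [|t IHt] /=.
  rewrite (bigD1 x)//= eqxx big1 ?addr0// => z.
  by rewrite eq_sym => /negPf ->.
rewrite exchange_big/= -[RHS]IHt; apply: eq_bigr => z _.
by rewrite -mulr_sumr Q_sum1 mulr1.
Qed.

Lemma nstep_gt0_add t t' x y z :
  0 < nstep Q t x y -> 0 < nstep Q t' y z -> 0 < nstep Q (t + t') x z.
Proof.
move=> xy yz; rewrite nstep_add (bigD1 y)//=.
apply: ltr_wpDr; last exact: mulr_gt0.
by apply: sumr_ge0 => w _; apply: mulr_ge0; exact: nstep_ge0.
Qed.

(** The possible return times to [x] are closed under addition and have gcd 1, so they include all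
    large times; a fixed path from [x] to [y] is then appended. Finiteness of [S * S] gives one
    threshold for all pairs. *)
Lemma nstep_eventually_gt0 :
  mc_ergodic Q -> \forall t \near \oo, forall x y, 0 < nstep Q t x y.
Proof.
move=> [irr aper].
suff H (p : S * S) : \forall t \near \oo, 0 < nstep Q t p.1 p.2.
  have allp : \forall t \near \oo, forall p : S * S, 0 < nstep Q t p.1 p.2.
    exact: filter_forall.
  by apply: filterS allp => t tpos x y; exact: (tpos (x, y)).
case: p => x y /=.
have [N NP] : exists N, forall n, (N <= n)%N -> 0 < nstep Q n x x.
  apply: (@add_closed_cofinite (fun n => 0 < nstep Q n x x)).
  - by rewrite /= eqxx ltr01.
  - by move=> m n; exact: nstep_gt0_add.
  - by move=> d; exact: aper.
have [k xy] := irr x y.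
exists (N + k)%N => //= t Nt; rewrite -(@subnK k t); last first.
  by apply: leq_trans Nt; rewrite leq_addl.
apply: nstep_gt0_add xy; apply: NP.
by rewrite leq_subRL ?(leq_trans _ Nt) ?leq_addl// addnC.
Qed.

Lemma stochastic_average_bounds (P : S -> S -> R) (f : S -> R) (a b : R) :
  (forall x y, 0 <= P x y) -> (forall x, \sum_y P x y = 1) ->
  (forall x, a <= f x <= b) -> forall x, a <= \sum_y P x y * f y <= b.
Proof.
move=> P0 P1 fab x.
rewrite -[leLHS]mul1r -[X in _ && (_ <= X)]mul1r -(P1 x) !mulr_suml.
by apply/andP; split; apply: ler_sum => y _; apply: ler_wpM2l => //;
  case/andP: (fab y).
Qed.

(* Doeblin: the common mass [e] at [y0] contracts the range of [f] by [1 - e]. *)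
Lemma stochastic_contraction (P : S -> S -> R) (f : S -> R) (e a b : R) (y0 : S) :
  (forall x y, 0 <= P x y) -> (forall x, \sum_y P x y = 1) ->
  (forall x, e <= P x y0) -> (forall x, a <= f x <= b) ->
  forall x, e * f y0 + (1 - e) * a <= \sum_y P x y * f y
            <= e * f y0 + (1 - e) * b.
Proof.
move=> P0 P1 eP fab x.
(* Removing mass [e] at [y0] from row [x] leaves nonnegative weights of total [1 - e]. *)
have -> : \sum_y P x y * f y
    = e * f y0 + \sum_y (P x y - e * (y == y0)%:R) * f y.
  under [in RHS]eq_bigr do rewrite mulrBl.
  rewrite sumrB [X in _ - X](bigD1 y0)//= eqxx mulr1.
  rewrite [X in _ - (_ + X)]big1 ?addr0 ?subrKC //.
  by move=> y /negPf ->; rewrite mulr0 mul0r.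
have -> : 1 - e = \sum_y (P x y - e * (y == y0)%:R).
  rewrite sumrB P1 (bigD1 y0)//= eqxx mulr1 big1 ?addr0//.
  by move=> y /negPf ->; rewrite mulr0.
have D0 y : 0 <= P x y - e * (y == y0)%:R.
  by case: eqP => [->|_]; rewrite ?mulr1 ?mulr0 ?subr0 ?subr_ge0.
by rewrite !lerD2l !mulr_suml; apply/andP; split; apply: ler_sum => y _;
  apply: ler_wpM2l => //; case/andP: (fab y).
Qed.

(** Each further block of [N] steps contracts the range of a column by [1 - e], starting from the
    range [[0, 1]]. The bound [a] serves all rows and all later times, since further steps only
    average the column. *)
Lemma nstep_squeeze (N : nat) (e : R) :
  (forall x y, e <= nstep Q N x y) ->
  forall (y : S) (k : nat), exists a, forall t x, (k * N <= t)%N ->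
    a <= nstep Q t x y <= a + (1 - e) ^+ k.
Proof.
move=> eN y; elim=> [|k [a IHk]].
  exists 0 => t x _; rewrite nstep_ge0 expr0 add0r -(nstep_sum1 t x).
  by rewrite (bigD1 y)//= lerDl sumr_ge0// => *; exact: nstep_ge0.
exists (e * nstep Q (k * N) y y + (1 - e) * a) => t x.
rewrite mulSn => Nt.
have step : forall z, e * nstep Q (k * N) y y + (1 - e) * a
    <= nstep Q (N + k * N) z y
    <= e * nstep Q (k * N) y y + (1 - e) * a + (1 - e) ^+ k.+1.
  move=> z; rewrite nstep_add -addrA exprS -mulrDr.
  apply: (stochastic_contraction (nstep Q N) (fun w => nstep Q (k * N) w y) e a _ y).
  - exact: nstep_ge0.
  - exact: nstep_sum1.
  - by [].
  - by move=> w; exact: IHk.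
rewrite -(subnK Nt) nstep_add.
by apply: stochastic_average_bounds => //; [exact: nstep_ge0|exact: nstep_sum1].
Qed.

End StochasticMatrix.

(** * Convergence of ergodic chains and uniqueness of invariant measures *)

Lemma cvg_common_limit {R : realType} {I : Type} (i0 : I) (v : nat -> I -> R) :
  (forall e : R, 0 < e ->
    exists a T, forall t, (T <= t)%N -> forall i, a <= v t i <= a + e) ->
  exists l : R, forall i, v t i @[t --> \oo] --> l.
Proof.
move=> sq.
have cv0 : cvg ((v t i0 : R) @[t --> \oo]).
  apply: cauchy_cvg; apply: (@cauchy_exP R R) => e e0.
  have [|a [T aT]] := sq (e / 2); first by rewrite divr_gt0.
  exists a; exists T => //= t /aT /(_ i0) /andP[av va].
  rewrite /ball/= ltr_distlC; lra.
(* The band [[a, a + e]] is the same for every index, so it contains both the limit at [i0] and the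
   tail of any other [v ^~ i]. *)
exists (lim (v t i0 @[t --> \oo])) => i; apply/cvgrPdist_le => e e0.
have [a [T aT]] := sq e e0.
have la : a <= lim (v t i0 @[t --> \oo]).
  by apply: limr_ge => //; exists T => //= t /aT /(_ i0) /andP[].
have lb : lim (v t i0 @[t --> \oo]) <= a + e.
  by apply: limr_le => //; exists T => //= t /aT /(_ i0) /andP[].
exists T => //= t /aT /(_ i) /andP[av va].
rewrite ler_distlC; lra.
Qed.

Section StochasticLimit.
Context {R : realType} {S : finType}.
Variable Q : S -> S -> R.
Hypothesis Q_ge0 : forall x y, 0 <= Q x y.
Hypothesis Q_sum1 : forall x, \sum_y Q x y = 1.

Lemma ergodic_cvg (x0 : S) : mc_ergodic Q ->
  exists mu : S -> R, (forall y, 0 < mu y) /\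
    forall x y, nstep Q t x y @[t --> \oo] --> mu y.
Proof.
move=> erg.
have [N _ /(_ N (leqnn N)) Npos] := nstep_eventually_gt0 Q Q_ge0 erg.
have [e e0 eN] : exists2 e : R, 0 < e & forall x y, e <= nstep Q N x y.
  case: (@arg_minP _ _ _ (x0, x0) xpredT (fun p : S * S => nstep Q N p.1 p.2)) => //.
  move=> p _ pmin; exists (nstep Q N p.1 p.2); first exact: Npos.
  by move=> x y; exact: (pmin (x, y)).
have e1 : e <= 1.
  apply: le_trans (eN x0 x0) _; rewrite -(nstep_sum1 Q Q_sum1 N x0).
  by rewrite (bigD1 x0)//= lerDl sumr_ge0// => *; exact: nstep_ge0.
have lim_y y : exists l : R, 0 < l /\ forall x, nstep Q t x y @[t --> \oo] --> l.
  have [|l lP] := @cvg_common_limit _ _ x0 (fun t x => nstep Q t x y).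
    move=> eps eps0.
    have /cvgrPdist_le /(_ eps eps0) [k _ /(_ k (leqnn k)) kP] :
        (1 - e) ^+ k @[k --> \oo] --> (0 : R).
      by apply: cvg_expr; rewrite ger0_norm ?subr_ge0// ltrBlDr ltrDl.
    have {}kP : (1 - e) ^+ k <= eps.
      by apply: le_trans kP; rewrite sub0r normrN ler_norm.
    have [a aP] := nstep_squeeze Q Q_ge0 Q_sum1 N e eN y k.
    exists a, (k * N)%N => t kt x; have /andP[-> h] /= := aP t x kt.
    by apply: le_trans h _; rewrite lerD2l.
  (* The limit is at least [e]: for [t >= N], a [t]-step probability averages [N]-step
     probabilities, all at least [e]. *)
  exists l; split; last exact: lP.
  apply: lt_le_trans e0 _; rewrite -(cvg_lim _ (lP x0))//.
  apply: limr_ge; first by apply/cvg_ex; exists l; exact: lP.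
  exists N => //= t Nt; rewrite -(subnK Nt) nstep_add -[e]mul1r.
  rewrite -(nstep_sum1 Q Q_sum1 (t - N) x0) mulr_suml.
  by apply: ler_sum => z _; rewrite ler_wpM2l// nstep_ge0.
have [mu muP] := choice lim_y.
by exists mu; split=> [y|x y]; case: (muP y).
Qed.

Variable mu : S -> R.
Hypothesis mu_cvg : forall x y, nstep Q t x y @[t --> \oo] --> mu y.

Lemma cvg_sum_nstep (c : S -> R) (x : S) :
  (\sum_y nstep Q t x y * c y) @[t --> \oo] --> \sum_y mu y * c y.
Proof.
apply: cvg_big => [|y _]; first exact: add_continuous.
by apply: cvgMr_tmp; exact: mu_cvg.
Qed.

Lemma limit_sum1 (x : S) : \sum_y mu y = 1.
Proof.
have := cvg_sum_nstep (fun=> 1) x.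
under eq_fun do (under eq_bigr do rewrite mulr1; rewrite nstep_sum1//).
under eq_bigr do rewrite mulr1.
by move/cvg_lim => <- //; rewrite lim_cst.
Qed.

Lemma limit_invariant (x y : S) : \sum_z mu z * Q z y = mu y.
Proof.
have := mu_cvg x y; rewrite -cvg_shiftS /= => h1.
exact: (cvg_unique _ (cvg_sum_nstep (Q ^~ y) x) h1).
Qed.

(** Invariance persists under all powers of [Q], whose rows all tend to [mu]; the limit keeps only
    the total mass of [nu]. *)
Lemma invariant_measure_unique (nu : S -> R) :
  (forall y, \sum_x nu x * Q x y = nu y) -> forall y, nu y = (\sum_x nu x) * mu y.
Proof.
move=> inv y.
have inv_t t : \sum_x nu x * nstep Q t x y = nu y.
  elim: t y => [|t IHt] y.
    rewrite /= (bigD1 y)//= eqxx mulr1 big1 ?addr0// => z /negPf ->.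
    by rewrite mulr0.
  rewrite -[RHS]inv /=.
  under eq_bigr do rewrite mulr_sumr.
  rewrite exchange_big/=; apply: eq_bigr => z _.
  by rewrite -IHt mulr_suml; apply: eq_bigr => w _; rewrite mulrA.
have lim_sum : (\sum_x nu x * nstep Q t x y) @[t --> \oo] --> \sum_x nu x * mu y.
  apply: cvg_big => [|x _]; first exact: add_continuous.
  by apply: cvgMl_tmp; exact: mu_cvg.
rewrite mulr_suml -(cvg_lim _ lim_sum)//.
by under eq_fun do rewrite inv_t; rewrite lim_cst.
Qed.

End StochasticLimit.

(** * Marginals of the trajectory law *)

Section TrajectoryMarginal.
Context {R : realType} {S A : finType}.
Variables (M : mdp R S A) (u : S -> A -> R).

(** Appending at the end matches the recursion of [nstep], which peels off the last step. *)
Definition ffun_rcons {T : Type} {t : nat} (p : {ffun 'I_t -> T} * T) :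
    {ffun 'I_t.+1 -> T} :=
  [ffun i => if unlift ord_max i is Some j then p.1 j else p.2].

Lemma ffun_rcons_max {T : Type} {t : nat} (p : {ffun 'I_t -> T} * T) :
  ffun_rcons p ord_max = p.2.
Proof. by rewrite ffunE unlift_none. Qed.

Lemma ffun_rcons_widen {T : Type} {t : nat} (p : {ffun 'I_t -> T} * T) (i : 'I_t) :
  ffun_rcons p (widen_ord (leqnSn t) i) = p.1 i.
Proof.
rewrite ffunE (_ : widen_ord _ i = lift ord_max i) ?liftK //.
by apply: val_inj; rewrite /= /bump leqNgt ltn_ord.
Qed.

Lemma ffun_rcons_bij {T : Type} {t : nat} :
  bijective (@ffun_rcons T t).
Proof.
exists (fun h : {ffun 'I_t.+1 -> T} =>
  ([ffun i => h (widen_ord (leqnSn t) i)], h ord_max)).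
- case=> h x; congr pair; last by rewrite ffun_rcons_max.
  by apply/ffunP => i; rewrite ffunE ffun_rcons_widen.
- move=> h; apply/ffunP => i; rewrite ffunE.
  case: unliftP => [j ->|-> //] /=; rewrite ffunE; congr (h _).
  by apply: val_inj; rewrite /= /bump leqNgt ltn_ord.
Qed.

Lemma traj_prob_rcons (s0 : S) (t : nat) (h : {ffun 'I_t.+1 -> S * A}) (x : S * A) :
  traj_prob M u s0 (ffun_rcons (h, x)) =
  traj_prob M u s0 h * trans M (h ord_max).1 (h ord_max).2 x.1 * u x.1 x.2.
Proof.
rewrite /traj_prob big_ord_recr [X in _ * _ * X = _]big_ord_recr /=.
have -> : (ord0 : 'I_t.+2) = widen_ord (leqnSn t.+1) ord0 by exact: val_inj.
rewrite ffun_rcons_widen ffun_rcons_max.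
have -> : lift (widen_ord (leqnSn t.+1) ord0) ord_max = (ord_max : 'I_t.+2).
  by apply: val_inj; rewrite /= /bump leq0n.
rewrite ffun_rcons_widen ffun_rcons_max /=.
under eq_bigr do rewrite ffun_rcons_widen /=.
under [X in _ * (X * _)]eq_bigr => i _.
  rewrite ffun_rcons_widen.
  have -> : lift (widen_ord (leqnSn t.+1) ord0) (widen_ord (leqnSn t) i)
          = widen_ord (leqnSn t.+1) (lift ord0 i) by exact: val_inj.
  rewrite ffun_rcons_widen /=.
  over.
ring.
Qed.

Lemma prob_atE (s0 : S) (t : nat) (s : S) (a : A) :
  U_RS M u -> prob_at M u s0 t s a = nstep (chain M u) t s0 s * u s a.
Proof.
move=> uRS; elim: t s a => [|t IHt] s a; rewrite /prob_at.
  rewrite (big_pred1 [ffun=> (s, a)]) => [|h /=].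
    by rewrite /traj_prob big_ord1 big_ord0 !ffunE mulr1 /= eq_sym.
  apply/eqP/eqP => [hmax|->]; last by rewrite ffunE.
  by apply/ffunP => i; rewrite ffunE -hmax; congr (h _); rewrite (ord1 i); exact: val_inj.
rewrite (reindex _ (onW_bij _ ffun_rcons_bij))/=.
under eq_bigl do rewrite ffun_rcons_max.
rewrite -(pair_big_dep xpredT (fun _ x => x == (s, a))
  (fun h x => traj_prob M u s0 (ffun_rcons (h, x))))/=.
under eq_bigr do rewrite big_pred1_eq traj_prob_rcons/=.
(* Grouping prefixes by their last state-action pair makes the induction hypothesis applicable, as
   the new factor depends only on that pair. *)
rewrite (partition_big (fun h : {ffun 'I_t.+1 -> S * A} => h ord_max) xpredT)//=.
rewrite -(pair_big xpredT xpredT (fun s' a' =>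
   \sum_(h : {ffun 'I_t.+1 -> S * A} | h ord_max == (s', a')) traj_prob M u s0 h *
     trans M (h ord_max).1 (h ord_max).2 s * u s a))/=.
rewrite mulr_suml; apply: eq_bigr => s' _.
have [u_ge0 u_out _] := uRS s'.
rewrite /chain mulr_sumr mulr_suml [RHS]big_mkcond/=.
apply: eq_bigr => a' _.
rewrite (eq_bigr (fun h => traj_prob M u s0 h * (trans M s' a' s * u s a))); last first.
  by move=> h /eqP ->; rewrite mulrA.
rewrite -mulr_suml -/(prob_at M u s0 t s' a') IHt.
case: ifPn => [_|/u_out ->]; last by rewrite mulr0 mul0r.
by rewrite !mulrA.
Qed.

End TrajectoryMarginal.

(** * Stationary laws of policies and removal of randomization *)

Section ErgodicMDP.
Context {R : realType} {S A : finType}.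
Variables (M : mdp R S A) (s0 : S).
Hypothesis ergodic : forall u : S -> A -> R, U_RS M u -> mc_ergodic (chain M u).

Lemma chain_ge0 (u : S -> A -> R) : U_RS M u -> forall x y, 0 <= chain M u x y.
Proof.
move=> uRS x y; have [u0 _ _] := uRS x.
by apply: sumr_ge0 => a aM; rewrite mulr_ge0// trans_ge0.
Qed.

Lemma sum_adm (u : S -> A -> R) (x : S) : U_RS M u -> \sum_(a in adm M x) u x a = 1.
Proof.
move=> uRS; have [_ u0 <-] := uRS x.
by rewrite [RHS](bigID (mem (adm M x)))/= [X in _ + X]big1 ?addr0.
Qed.

Lemma chain_sum1 (u : S -> A -> R) : U_RS M u -> forall x, \sum_y chain M u x y = 1.
Proof.
move=> uRS x; rewrite exchange_big/= -(sum_adm u x uRS); apply: eq_bigr => a aM.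
by rewrite -mulr_sumr trans_sum1// mulr1.
Qed.

Definition stat (u : S -> A -> R) (y : S) : R :=
  lim (nstep (chain M u) t s0 y @[t --> \oo]).

Lemma stat_spec (u : S -> A -> R) : U_RS M u ->
  (forall y, 0 < stat u y) /\
  forall x y, nstep (chain M u) t x y @[t --> \oo] --> stat u y.
Proof.
move=> uRS.
have [mu [mu0 mucvg]] :=
  ergodic_cvg _ (chain_ge0 _ uRS) (chain_sum1 _ uRS) s0 (ergodic _ uRS).
have statE y : stat u y = mu y by apply: cvg_lim.
by split=> [y|x y]; rewrite statE.
Qed.

Lemma FcdfE (u : S -> A -> R) (l : R) : U_RS M u ->
  Fcdf M s0 u l = \sum_s \sum_(a in adm M s | reward M s a <= l) stat u s * u s a.
Proof.
move=> uRS; apply: eq_bigr => s _; apply: eq_bigr => a _.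
have [_ cv] := stat_spec _ uRS.
apply: cvg_lim => //.
under eq_fun do rewrite prob_atE//.
by apply: cvgMr_tmp; exact: cv.
Qed.

Definition set_action (u : S -> A -> R) (s : S) (a : A) : S -> A -> R :=
  fun x b => if x == s then (b == a)%:R else u x b.

Lemma dirac_U_RS (x : S) (a : A) : a \in adm M x ->
  [/\ forall b, 0 <= (b == a)%:R :> R, forall b, b \notin adm M x -> (b == a)%:R = 0 :> R
    & \sum_b (b == a)%:R = 1 :> R].
Proof.
move=> aM; split=> [b|b|].
- exact: ler0n.
- by case: eqP => [->|//]; rewrite aM.
- by rewrite (bigD1 a)//= eqxx big1 ?addr0// => b /negPf ->.
Qed.

Lemma set_action_U_RS (u : S -> A -> R) (s : S) (a : A) :
  U_RS M u -> a \in adm M s -> U_RS M (set_action u s a).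
Proof.
move=> uRS aM x; rewrite /set_action.
by case: eqP => [->|_]; [exact: dirac_U_RS|exact: uRS].
Qed.

Lemma det_U_RS (d : {ffun S -> A}) : U_DS M d -> U_RS M (det d).
Proof. by move=> dM x; apply: dirac_U_RS; exact: dM. Qed.

(* The weights [u s a / stat (u_a) s], where [u_a] plays [a] at [s], make the
   mixture of the occupation measures of the [u_a] proportional to that of [u]. *)
Lemma derandomize_state (u : S -> A -> R) (s : S) (l : R) : U_RS M u ->
  exists2 a, a \in adm M s & Fcdf M s0 (set_action u s a) l <= Fcdf M s0 u l.
Proof.
move=> uRS; have [u_ge0 _ _] := uRS s.
pose v a := set_action u s a.
have vRS a : a \in adm M s -> U_RS M (v a) by exact: set_action_U_RS.
pose w a := u s a / stat (v a) s.
have v_s a b : v a s b = (b == a)%:R by rewrite /v /set_action eqxx.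
have stat_neq0 a : a \in adm M s -> stat (v a) s != 0.
  by move=> aM; rewrite gt_eqF//; have [+ _] := stat_spec _ (vRS a aM).
have w_ge0 a : a \in adm M s -> 0 <= w a.
  move=> aM; rewrite divr_ge0// ltW//.
  by have [+ _] := stat_spec _ (vRS a aM).
pose nu x := \sum_(a in adm M s) w a * stat (v a) x.
(* Away from [s] every [v a] agrees with [u]. At [s] only [v b] plays [b]; its weight cancels
   [stat (v b) s] and leaves [u s b], while [nu s = 1]. *)
have occupation x b : b \in adm M x ->
    \sum_(a in adm M s) w a * (stat (v a) x * v a x b) = nu x * u x b.
  move=> bM; rewrite mulr_suml.
  have [xs|xs] := eqVneq x s; last first.
    by apply: eq_bigr => a _; rewrite /v /set_action (negPf xs) mulrA.
  rewrite xs in bM *.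
  rewrite (bigD1 b)//= big1 ?addr0 => [|a /andP[aM ab]]; last first.
    by rewrite v_s eq_sym (negPf ab) !mulr0.
  rewrite v_s eqxx mulr1 divfK ?stat_neq0// -mulr_suml.
  rewrite (eq_bigr (u s)) ?sum_adm ?mul1r// => a aM.
  by rewrite divfK ?stat_neq0.
have nu_inv y : \sum_x nu x * chain M u x y = nu y.
  transitivity (\sum_(a in adm M s) w a * \sum_x stat (v a) x * chain M (v a) x y).
    under [RHS]eq_bigr do rewrite mulr_sumr.
    rewrite exchange_big/=; apply: eq_bigr => x _.
    under [RHS]eq_bigr do rewrite !mulr_sumr.
    rewrite exchange_big/= mulr_sumr; apply: eq_bigr => b bM.
    rewrite mulrA -occupation// mulr_suml.
    by apply: eq_bigr => a _; rewrite !mulrA.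
  apply: eq_bigr => a aM; congr (_ * _).
  have [_ cv] := stat_spec _ (vRS a aM).
  exact: limit_invariant _ _ cv s0 y.
have [_ ucv] := stat_spec _ uRS.
have nuE := invariant_measure_unique _ _ ucv nu nu_inv.
have nu_sum : \sum_x nu x = \sum_(a in adm M s) w a.
  rewrite exchange_big/=; apply: eq_bigr => a aM.
  have [_ cv] := stat_spec _ (vRS a aM).
  by rewrite -mulr_sumr (limit_sum1 _ (chain_sum1 _ (vRS a aM)) _ cv s0) mulr1.
(* [Fcdf] is linear in the occupation measure, and [nu] has total mass [\sum_a w a]. *)
have mix : \sum_(a in adm M s) w a * (Fcdf M s0 (v a) l - Fcdf M s0 u l) = 0.
  under eq_bigr do rewrite mulrBr.
  rewrite sumrB -mulr_suml -nu_sum; apply/eqP; rewrite subr_eq0; apply/eqP.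
  rewrite (FcdfE u)//.
  transitivity (\sum_(a in adm M s) \sum_x \sum_(b in adm M x | reward M x b <= l)
    w a * (stat (v a) x * v a x b)).
    apply: eq_bigr => a aM; rewrite (FcdfE _ _ (vRS a aM)) mulr_sumr.
    by apply: eq_bigr => x _; rewrite mulr_sumr.
  rewrite exchange_big/= [RHS]mulr_sumr; apply: eq_bigr => x _.
  rewrite exchange_big/= mulr_sumr; apply: eq_bigr => b /andP[bM _].
  by rewrite occupation// nuE mulrA.
(* If every [v a] were strictly worse, the terms of [mix] would be nonnegative with sum zero, so all
   weights would vanish, and with them the whole distribution [u s]. *)
apply: contrapT => no_a.
have gt_F a : a \in adm M s -> Fcdf M s0 u l < Fcdf M s0 (v a) l.
  by move=> aM; rewrite ltNge; apply/negP => le_a; apply: no_a; exists a.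
have w0 a : a \in adm M s -> w a = 0.
  move=> aM; have := mix; move/eqP; rewrite psumr_eq0 => [/allP|b bM].
    move/(_ a (mem_index_enum a)); rewrite aM/= mulf_eq0 => /orP[/eqP//|].
    by rewrite subr_eq0 gt_eqF ?gt_F.
  by rewrite mulr_ge0 ?w_ge0// subr_ge0 ltW ?gt_F.
suff : (1 : R) = 0 by move/eqP; rewrite oner_eq0.
rewrite -(sum_adm u s uRS) big1// => a aM.
by rewrite -[LHS](divfK (stat_neq0 a aM)) -/(w a) w0// mul0r.
Qed.

Lemma derandomize (u : S -> A -> R) (l : R) : U_RS M u ->
  exists2 d, U_DS M d & Fcdf M s0 (det d) l <= Fcdf M s0 u l.
Proof.
move=> uRS.
(* Fixing the action at one more state leaves the states already treated deterministic, so an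
   induction along [enum S] reaches all of them. *)
have H (xs : seq S) : exists v, [/\ U_RS M v, Fcdf M s0 v l <= Fcdf M s0 u l
    & forall x, x \in xs -> exists2 a, a \in adm M x & forall b, v x b = (b == a)%:R].
  elim: xs => [|s xs [v [vRS vF vdet]]]; first by exists u.
  have [a aM aF] := derandomize_state v s l vRS.
  exists (set_action v s a); split.
  - exact: set_action_U_RS.
  - exact: le_trans aF vF.
  - move=> x; rewrite inE /set_action.
    by case: eqP => [->|_ /vdet//]; exists a.
have [v [vRS vF vdet]] := H (enum S).
have /choice[d dP] x : exists a, a \in adm M x /\ forall b, v x b = (b == a)%:R.
  by have [|a aM ab] := vdet x; [rewrite mem_enum|exists a].
exists [ffun x => d x] => [x|]; first by rewrite ffunE; case: (dP x).
suff -> : det [ffun x => d x] = v by [].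
by apply/funext => x; apply/funext => a; rewrite /det ffunE; case: (dP x).
Qed.

End ErgodicMDP.

(** * Value at risk and the policy iteration *)

Section ValueAtRisk.
Context {R : realType} {S A : finType}.
Variables (M : mdp R S A) (s0 : S) (alpha : R).
Hypothesis alpha_gt0 : 0 < alpha.
Hypothesis alpha_le1 : alpha <= 1.
Hypothesis ergodic : forall u : S -> A -> R, U_RS M u -> mc_ergodic (chain M u).

Lemma Fcdf_homo (u : S -> A -> R) (l l' : R) : U_RS M u -> l <= l' ->
  Fcdf M s0 u l <= Fcdf M s0 u l'.
Proof.
move=> uRS ll'; rewrite !(FcdfE _ _ ergodic _ _ uRS).
apply: ler_sum => s _; rewrite big_mkcondr [leRHS]big_mkcondr/=.
have [st0 _] := stat_spec _ s0 ergodic _ uRS; have [u0 _ _] := uRS s.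
have su0 a : 0 <= stat M s0 u s * u s a by rewrite mulr_ge0// ltW.
apply: ler_sum => a _; case: ifPn => [rl|_]; last by case: ifP.
by rewrite (le_trans rl).
Qed.

Lemma Fcdf_total (u : S -> A -> R) (l : R) : U_RS M u ->
  (forall s a, a \in adm M s -> reward M s a <= l) -> Fcdf M s0 u l = 1.
Proof.
move=> uRS rl; rewrite (FcdfE _ _ ergodic _ _ uRS).
have [_ cv] := stat_spec _ s0 ergodic _ uRS.
rewrite -(limit_sum1 _ (chain_sum1 _ _ uRS) _ cv s0).
apply: eq_bigr => s _; rewrite -[RHS]mulr1 -(sum_adm _ u s uRS) mulr_sumr.
by apply: eq_bigl => a; case: (boolP (a \in adm M s)) => //= /rl ->.
Qed.

(** The distribution function is constant between consecutive rewards; the pair chosen has the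
    largest admissible reward not above [l]. *)
Lemma Fcdf_attained (u : S -> A -> R) (l : R) : 0 < Fcdf M s0 u l ->
  exists s a, [/\ a \in adm M s, reward M s a <= l &
    Fcdf M s0 u (reward M s a) = Fcdf M s0 u l].
Proof.
move=> F0; pose K (p : S * A) := (p.2 \in adm M p.1) && (reward M p.1 p.2 <= l).
have [p0 Kp0] : exists p, K p.
  apply: contrapT => /forallNP noK; move: F0.
  rewrite /Fcdf big1 ?ltxx// => s _; rewrite big_pred0// => a.
  by apply/negP => Ka; exact: (noK (s, a)).
case: (arg_maxP (fun p => reward M p.1 p.2) Kp0) => -[s a] /andP[/= aM rl] rmax.
exists s, a; split=> //; apply: eq_bigr => x _; apply: eq_bigl => b.
case: (boolP (b \in adm M x)) => //= bM.
apply/idP/idP => [|xl]; first by move/le_trans; apply.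
by apply: (rmax (x, b)); rewrite /K/= bM.
Qed.

(** The infimum defining [VaR] is attained, at the least reward whose distribution function reaches
    [alpha]; monotonicity then gives the equivalence. *)
Lemma le_VaR (u : S -> A -> R) (l : R) : U_RS M u ->
  (VaR M s0 alpha u <= l) = (alpha <= Fcdf M s0 u l).
Proof.
move=> uRS; pose K (p : S * A) := p.2 \in adm M p.1.
pose r (p : S * A) := reward M p.1 p.2.
have [a0 a0M] := adm_nonempty M s0.
have Kp0 : K (s0, a0) by [].
pose K' p := K p && (alpha <= Fcdf M s0 u (r p)).
(* At the largest reward the distribution function is 1, hence at least [alpha]. *)
have [p1 K'p1] : exists p, K' p.
  case: (arg_maxP r Kp0) => p1 Kp1 rmax; exists p1; rewrite /K' Kp1/=.
  by rewrite Fcdf_total// => s a aM; exact: (rmax (s, a)).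
case: (arg_minP r K'p1) => p /andP[Kp Fp] rmin.
have lb m : alpha <= Fcdf M s0 u m -> r p <= m.
  move=> Fm; have [s [a [aM am Feq]]] := Fcdf_attained _ _ (lt_le_trans alpha_gt0 Fm).
  by apply: le_trans am; apply: (rmin (s, a)); rewrite /K' /K /r/= aM Feq.
have -> : VaR M s0 alpha u = r p.
  apply/le_anti/andP; split.
  - by apply: ge_inf => //; exists (r p) => m; exact: lb.
  - by apply: lb_le_inf; [exists (r p)|move=> m; exact: lb].
by apply/idP/idP => [/(Fcdf_homo _ _ _ uRS)|/lb//]; exact: le_trans.
Qed.

Lemma U_DS_nonempty : exists d, U_DS M d.
Proof.
have /choice[f fM] := adm_nonempty M.
by exists [ffun x => f x] => x; rewrite ffunE.
Qed.

(** The set of values is nonempty and bounded below by 0, so its [inf] is a genuine greatest lower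
    bound and not the default value. *)
Lemma F_star_glb (m l : R) :
  m <= F_star M s0 l <-> forall d, U_DS M d -> m <= Fcdf M s0 (det d) l.
Proof.
have Fge0 d : U_DS M d -> 0 <= Fcdf M s0 (det d) l.
  move=> dM; have dRS := det_U_RS _ _ dM.
  rewrite (FcdfE _ _ ergodic _ _ dRS).
  apply: sumr_ge0 => s _; apply: sumr_ge0 => a _.
  by have [st0 _] := stat_spec _ s0 ergodic _ dRS; rewrite mulr_ge0 ?ler0n// ltW.
split=> [mF d dM|mF].
  apply: le_trans mF _; apply: ge_inf; last by exists d.
  by exists 0 => _ [d' d'M <-]; exact: Fge0.
apply: lb_le_inf => [|_ [d dM <-]]; last exact: mF.
by have [d dM] := U_DS_nonempty; exists (Fcdf M s0 (det d) l); exists d.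
Qed.

Lemma VaR_improves (d d' : {ffun S -> A}) : continues M s0 alpha d ->
  argmin_DS M s0 (VaR M s0 alpha (det d)) d' ->
  VaR M s0 alpha (det d) < VaR M s0 alpha (det d').
Proof.
move=> dcont [d'M d'min]; rewrite ltNge le_VaR; last exact: det_U_RS.
(* As a minimizer, [d'] has a value at most [F_star], which is below [alpha]. *)
rewrite -ltNge; apply: le_lt_trans dcont.
by apply/F_star_glb.
Qed.

Lemma VaR_optimal (d : {ffun S -> A}) : U_DS M d -> ~ continues M s0 alpha d ->
  VaR M s0 alpha (det d) = VaR_star M s0 alpha.
Proof.
move=> dM /negP; rewrite -leNgt => /F_star_glb stop.
have ub v : U_RS M v -> VaR M s0 alpha v <= VaR M s0 alpha (det d).
  move=> vRS; rewrite le_VaR//.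
  have [d' d'M d'F] := derandomize M s0 ergodic v (VaR M s0 alpha (det d)) vRS.
  by apply: le_trans d'F; exact: stop.
have dRS := det_U_RS _ _ dM.
apply/le_anti/andP; split.
- apply: ub_le_sup; last by exists (det d).
  by exists (VaR M s0 alpha (det d)) => _ [v vRS <-]; exact: ub.
- apply: ge_sup; first by exists (VaR M s0 alpha (det d)); exists (det d).
  by move=> _ [v vRS <-]; exact: ub.
Qed.

Lemma PI_run_stops (u : nat -> {ffun S -> A}) : PI_run M s0 alpha u ->
  exists n, PI_stops_at M s0 alpha u n.
Proof.
move=> [_ step].
have [n stop] : exists n, ~ continues M s0 alpha (u n).
  apply: contrapT => /forallNP all_cont.
  have cont k : continues M s0 alpha (u k) by exact: contrapT.
  pose V k := VaR M s0 alpha (det (u k)).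
  have V_incr j k : (j < k)%N -> V j < V k.
    move: j k; apply: (@homo_ltn _ V <%R) => [y x z|k]; first exact: lt_trans.
    by apply: VaR_improves => //; exact: step.
  have V_neq j k : u j = u k -> ~~ (j < k)%N.
    by move=> ujk; apply/negP => /V_incr; rewrite /V ujk ltxx.
  have u_inj : injective u.
    by move=> j k ujk; case: (ltngtP j k) (V_neq j k ujk) (V_neq k j (esym ujk)).
  (* Pigeonhole: one more iterate than there are maps from [S] to [A]. *)
  have /leq_card : injective (fun k : 'I_#|{ffun S -> A}|.+1 => u k).
    by move=> j k /u_inj /val_inj.
  by rewrite card_ord ltnn.
pose halted k := `[< ~ continues M s0 alpha (u k) >].
have exh : exists k, halted k by exists n; apply/asboolP.
have [m /asboolP mstop mmin] := ex_minnP exh.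
exists m; split=> // k km; apply: contrapT => kstop.
by have := mmin k (asboolT kstop); rewrite leqNgt km.
Qed.

Lemma PI_run_U_DS (u : nat -> {ffun S -> A}) (n : nat) : PI_run M s0 alpha u ->
  PI_stops_at M s0 alpha u n -> U_DS M (u n).
Proof.
(* A later iterate is a minimizer chosen by the preceding step, hence deterministic and
   admissible. *)
move=> [u0 step] [cont _]; case: n cont => [//|n] cont.
by have [] := step n (fun j jn => cont j jn).
Qed.

End ValueAtRisk.

Theorem theorem4 (R : realType) (S A : finType) (M : mdp R S A) (s0 : S)
    (alpha : R) (alpha_gt0 : 0 < alpha) (alpha_le1 : alpha <= 1)
    (ergodic : forall u : S -> A -> R, U_RS M u -> mc_ergodic (chain M u))
    (u : nat -> {ffun S -> A}) (run : PI_run M s0 alpha u) :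
  exists n : nat,
    PI_stops_at M s0 alpha u n /\
    VaR M s0 alpha (det (u n)) = VaR_star M s0 alpha.
Proof.
have [n stop] := PI_run_stops M s0 alpha alpha_gt0 alpha_le1 ergodic u run.
exists n; split=> //; case: (stop) => _ halt.
by apply: VaR_optimal => //; exact: PI_run_U_DS run stop.
Qed.
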